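(* For real $p>0$ define functions on $\mathbb{R}$ by $\phi_p(x):=|x|^p$ and $\psi_p(x):=(\mathrm{sign}\,x)|x|^p$, and set $\phi_0(x):=1$ and $\psi_0(x):=\mathrm{sign}\,x$ for $x\in\mathbb{R}$, where $\mathrm{sign}\,x=-1,0,1$ according as $x<0$, $x=0$, $x>0$. Let $n$ be an integer and $p\ge 0$ a real number. (i) If $n\ge2$ and $p\ge n-2$, then $\phi_p,\psi_p\in S_{\mathrm{pos}}^{(n)}(-\infty,\infty)$. (ii) If $n\ge1$ and $p\ge n-1$, then $\phi_p,\psi_p\in S_{\mathrm{mono}}^{(n)}(-\infty,\infty)$. (iii) If $n\ge1$ and $p\ge n$, then $\phi_p,\psi_p\in S_{\mathrm{conv}}^{(n)}(-\infty,\infty)$.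
   Context: For a real function $f$ on $\mathbb{R}$ and a real matrix $A=[a_{ij}]$, $f[A]:=[f(a_{ij})]$. For real symmetric matrices, $A\ge0$ means positive semidefinite, and $A\ge B$ means $A-B\ge0$. The following are sets of real functions $f$ on $\mathbb{R}$: - $S_{\mathrm{pos}}^{(n)}(-\infty,\infty)$: those with $f[A]\ge0$ for all $A\ge0$ in $M_n(\mathbb{R})$. - $S_{\mathrm{mono}}^{(n)}(-\infty,\infty)$: those for which $A\ge B\ge0$ implies $f[A]\ge f[B]$ for all symmetric $A,B\in M_n(\mathbb{R})$. - $S_{\mathrm{conv}}^{(n)}(-\infty,\infty)$: those for which $A\ge B\ge0$ implies $f[\lambda A+(1-\lambda)B]\le\lambda f[A]+(1-\lambda)f[B]$ for all $0\le\lambda\le1$, for all symmetric $A,B\in M_n(\mathbb{R})$. *)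

(* Defs.v *)
From mathcomp Require Import all_boot all_order all_algebra.
From mathcomp Require Import boolp classical_sets reals exp.

Set Implicit Arguments.
Unset Strict Implicit.
Unset Printing Implicit Defensive.

Import Order.TTheory GRing.Theory Num.Theory.
Local Open Scope classical_set_scope.
Local Open Scope ring_scope.

Definition psdmx (R : realType) (n : nat) (A : 'M[R]_n) : Prop :=
  A \is symmetricmx /\ forall x : 'cV[R]_n, 0 <= (x^T *m A *m x) 0 0.

Definition lemx (R : realType) (n : nat) (A B : 'M[R]_n) : Prop :=
  psdmx (B - A).

(* [map_mx f A] is the entrywise function f[A]. *)

Definition S_pos (R : realType) (n : nat) : set (R -> R) :=
  [set f | forall A : 'M[R]_n, psdmx A -> psdmx (map_mx f A)].

Definition S_mono (R : realType) (n : nat) : set (R -> R) :=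
  [set f | forall A B : 'M[R]_n, A \is symmetricmx -> B \is symmetricmx ->
     lemx B A -> psdmx B -> lemx (map_mx f B) (map_mx f A)].

Definition S_conv (R : realType) (n : nat) : set (R -> R) :=
  [set f | forall A B : 'M[R]_n, A \is symmetricmx -> B \is symmetricmx ->
     lemx B A -> psdmx B ->
     forall l : R, 0 <= l <= 1 ->
       lemx (map_mx f (l *: A + (1 - l) *: B))
            (l *: map_mx f A + (1 - l) *: map_mx f B)].

(* The library's [powR] satisfies [0 `^ 0 = 1] and [0 `^ p = 0] for [p != 0],
   so the conventions at [p = 0] need no separate case: see [phi0], [psi0]. *)

Definition phi (R : realType) (p : R) : R -> R := fun x => `|x| `^ p.

Definition psi (R : realType) (p : R) : R -> R :=
  fun x => Num.sg x * `|x| `^ p.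

Lemma symmetricmxP (R : realType) (n : nat) (A : 'M[R]_n) :
  reflect (A^T = A) (A \is symmetricmx).
Proof.
rewrite qualifE /= expr0 scale1r map_mx_id //.
by apply: (iffP eqP) => /esym.
Qed.

Lemma phi0 (R : realType) (x : R) : phi 0 x = 1.
Proof. exact: powRr0. Qed.

Lemma psi0 (R : realType) (x : R) : psi 0 x = Num.sg x.
Proof. by rewrite /psi powRr0 mulr1. Qed.

(* Main.v *)
Require Import Defs.
From mathcomp Require Import all_boot all_order all_algebra.
From mathcomp Require Import ring lra.
From mathcomp Require Import boolp classical_sets functions reals exp.
From mathcomp Require Import topology normedtype derive realfun.

(** Write [f] for one of the two power functions of exponent [p].  The two
families are exchanged by differentiation: for [p > 1], the derivative of
[|x|^p] is [p] times the signed power of exponent [p - 1], and conversely.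
Both are treated at once as [spow s p], with [s] telling whether there is a
sign.

For [C = A - B] positive semidefinite, differentiating the quadratic form of
[f[B + t C]] along the segment from [B] to [A] gives the quadratic form of the
entrywise product of [C] with [f'[B + t C]].  By the Schur product theorem
([schur]) it is nonnegative as soon as [f'] preserves positivity, and
nondecreasing in [t] as soon as [f'] is monotone.  Hence, by the mean value
theorem, positivity for [f'] gives monotonicity for [f] in the same size
([mono_on_of_pos]), and monotonicity for [f'] gives convexity for [f]
([conv_on_of_mono]).

The remaining link raises the size by one ([pos_on_of_mono]): every positive
semidefinite [A] dominates a rank one matrix [z z^T] having the same row [s] as
[A] ([psd_peel]).  Since [f] is multiplicative, [f[z z^T]] has rank one and is
positive semidefinite; the difference [f[A] - f[z z^T]] has zero row and column
[s], so it only has to be controlled on the other indices, where monotonicity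
in the smaller size applies.

Together these links go from monotonicity in size [m] with exponent [p - 1] to
monotonicity in size [m + 1] with exponent [p].  The induction starts at size
one with any [p >= 0], where the diagonal entries are nonnegative and [f] is
nondecreasing there.  The only exponent reached later at which [f] may fail to
be differentiable is [p = 1], in size two, where the reverse triangle
inequality does the job ([spow1_mono_on]).  For convexity, [p = 1] occurs only in
size one, where both functions are the identity on the relevant entries.

Sizes are lowered without changing the type of matrices, by restricting the
quadratic form to vectors supported in a set [S] of indices. *)

Set Implicit Arguments.
Unset Strict Implicit.
Unset Printing Implicit Defensive.

Import Order.TTheory GRing.Theory Num.Theory numFieldNormedType.Exports.
Local Open Scope ring_scope.

(** * Quadratic forms and positive semidefinite matrices *)

Section QuadraticForms.
Context {R : realType} {n : nat}.
Implicit Types (s : 'I_n) (K A B C D : 'M[R]_n) (x y z : 'I_n -> R).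
Implicit Types (S : {set 'I_n}).

Definition qform K x : R := \sum_i \sum_j x i * x j * K i j.

(** For symmetric [K], positive semidefiniteness of the principal submatrix of
[K] indexed by [S]. *)
Definition psd_on S K : Prop :=
  forall x, (forall i, i \notin S -> x i = 0) -> 0 <= qform K x.

Lemma qformD K D x : qform (K + D) x = qform K x + qform D x.
Proof.
rewrite /qform -big_split /=; apply: eq_bigr => i _.
by rewrite -big_split /=; apply: eq_bigr => j _; rewrite mxE mulrDr.
Qed.

Lemma qformZ a K x : qform (a *: K) x = a * qform K x.
Proof.
rewrite /qform mulr_sumr; apply: eq_bigr => i _.
by rewrite mulr_sumr; apply: eq_bigr => j _; rewrite mxE mulrCA.
Qed.

Lemma qformB K D x : qform (K - D) x = qform K x - qform D x.
Proof. by rewrite qformD -scaleN1r qformZ mulN1r. Qed.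

Lemma qform_rank1 z x :
  qform (\matrix_(i, j) (z i * z j)) x = (\sum_i x i * z i) ^+ 2.
Proof.
rewrite expr2 mulr_suml; apply: eq_bigr => i _.
by rewrite mulr_sumr; apply: eq_bigr => j _; rewrite mxE mulrACA.
Qed.

Lemma qform_single K x s :
  (forall i, i != s -> x i = 0) -> qform K x = x s ^+ 2 * K s s.
Proof.
move=> x0; rewrite /qform (bigD1 s) //= [X in _ + X]big1 => [|i /x0 xi].
  rewrite addr0 (bigD1 s) //= [X in _ + X]big1 ?addr0 // => j /x0 xj.
  by rewrite xj mulr0 mul0r.
by apply: big1 => j _; rewrite xi !mul0r.
Qed.

Lemma qform_pair K x a b : K^T = K -> a != b ->
    (forall i, i \notin [set a; b] -> x i = 0) ->
  qform K x = x a ^+ 2 * K a a + 2 * (x a * x b * K a b) + x b ^+ 2 * K b b.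
Proof.
move=> symK ab x0.
have two (F : 'I_n -> R) :
    (forall i, i \notin [set a; b] -> F i = 0) -> \sum_i F i = F a + F b.
  move=> F0; rewrite (bigD1 a) //= (bigD1 b) /= 1?eq_sym //.
  rewrite [X in _ + (_ + X)]big1 ?addr0 // => i /andP[ia ib].
  by apply: F0; rewrite !inE negb_or ia.
rewrite /qform two => [|i /x0 xi].
  rewrite !two; first last.
  - by move=> i /x0 xi; rewrite xi mulr0 mul0r.
  - by move=> i /x0 xi; rewrite xi mulr0 mul0r.
  have -> : K b a = K a b by rewrite -{1}symK mxE.
  by ring.
by apply: big1 => j _; rewrite xi !mul0r.
Qed.

Lemma qform_drop K x s :
    (forall i j, (i == s) || (j == s) -> K i j = 0) ->
  qform K x = qform K (fun i => if i == s then 0 else x i).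
Proof.
move=> K0; apply: eq_bigr => i _; apply: eq_bigr => j _.
case: (boolP ((i == s) || (j == s))) => [/K0 ->|]; first by rewrite !mulr0.
by rewrite negb_or => /andP[/negPf -> /negPf ->].
Qed.

Lemma qform_shift A x s t : A^T = A ->
  qform A (fun i => x i + t * (i == s)%:R) =
    qform A x + 2 * t * (\sum_j A s j * x j) + t ^+ 2 * A s s.
Proof.
move=> symA.
have delta (F : 'I_n -> R) : \sum_i (i == s)%:R * F i = F s.
  rewrite (bigD1 s) //= eqxx mul1r big1 ?addr0 // => i /negPf ->.
  by rewrite mul0r.
have -> : qform A (fun i => x i + t * (i == s)%:R) =
    \sum_i (\sum_j x i * x j * A i j + t * (x i * \sum_j (j == s)%:R * A i j)
      + (i == s)%:R * (t * \sum_j A i j * x j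
                       + t ^+ 2 * \sum_j (j == s)%:R * A i j)).
  apply: eq_bigr => i _; rewrite mulrDr !mulr_sumr -!big_split /=.
  by apply: eq_bigr => j _; ring.
under eq_bigr do rewrite delta.
rewrite !big_split /= (delta (fun i => t * _ + _)) -mulr_sumr -/(qform A x).
have -> : \sum_i x i * A i s = \sum_j A s j * x j.
  by apply: eq_bigr => i _; rewrite -{1}symA mxE mulrC.
by ring.
Qed.

Lemma psdmxE A : psdmx A <-> A^T = A /\ psd_on [set: 'I_n] A.
Proof.
have formE (v : 'cV[R]_n) : (v^T *m A *m v) 0 0 = qform A (fun i => v i 0).
  rewrite mxE /qform exchange_big; apply: eq_bigr => j _.
  rewrite mxE mulr_suml; apply: eq_bigr => i _.
  by rewrite mxE mulrAC.
split=> -[/symmetricmxP symA psdA]; split=> //.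
- move=> x _; have := psdA (\col_i x i); rewrite formE.
  rewrite /qform; under eq_bigr do under eq_bigr do rewrite !mxE.
  by [].
- by move=> v; rewrite formE; apply: psdA => i; rewrite inE.
Qed.

Lemma psd_qform A x : psdmx A -> 0 <= qform A x.
Proof. by move=> /psdmxE[_]; apply => i; rewrite inE. Qed.

Lemma psd_sym A : psdmx A -> A^T = A.
Proof. by move=> /psdmxE[]. Qed.

Lemma psd_diag A s : psdmx A -> 0 <= A s s.
Proof.
move=> /(psd_qform (fun i => (i == s)%:R)).
by rewrite (@qform_single _ _ s) => [|i /negPf -> //]; rewrite eqxx expr1n mul1r.
Qed.

Lemma psdD A B : psdmx A -> psdmx B -> psdmx (A + B).
Proof.
move=> pA pB; apply/psdmxE; split; first by rewrite linearD /= !psd_sym.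
by move=> x _; rewrite qformD addr_ge0 // psd_qform.
Qed.

Lemma psdZ t A : 0 <= t -> psdmx A -> psdmx (t *: A).
Proof.
move=> t0 pA; apply/psdmxE; split; first by rewrite linearZ /= psd_sym.
by move=> x _; rewrite qformZ mulr_ge0 // psd_qform.
Qed.

Lemma psd_rank1 z : psdmx (\matrix_(i, j) (z i * z j)).
Proof.
apply/psdmxE; split; first by apply/matrixP => i j; rewrite !mxE mulrC.
by move=> x _; rewrite qform_rank1 sqr_ge0.
Qed.

(** The form is affine in [t] along [e_j + t e_s], hence bounded below only if
its slope vanishes. *)
Lemma psd_row0 A s j : psdmx A -> A s s = 0 -> A s j = 0.
Proof.
move=> pA Ass; have symA := psd_sym pA.
(* chosen so that the form takes the value -1 *)
pose t : R := - (A j j + 1) / (2 * A s j).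
apply/eqP/negP => /negP Asj.
have := psd_qform (fun i => (i == j)%:R + t * (i == s)%:R) pA.
rewrite qform_shift // (@qform_single _ _ j) => [|i /negPf -> //].
rewrite eqxx Ass (bigD1 j) //= big1 => [|i /negPf ->]; last by rewrite mulr0.
rewrite eqxx (_ : _ + _ = - 1); first by rewrite lerNr oppr0 ler10.
by rewrite /t /= mulr1 addr0; field.
Qed.

(** One step of Cholesky elimination: [z] is column [s] of [A] divided by the
square root of the pivot, and [A - z z^T] is the Schur complement.  The value of
its form at [x] is that of [A] at the minimizer of the form over the line
[x + t e_s].  When the pivot is zero, division by zero gives [z = 0], which is
the right choice because row [s] of [A] then vanishes.  The last clause ensures
that elimination creates no new nonzero row. *)
Lemma psd_peel A s : psdmx A ->
  exists z : 'I_n -> R,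
    [/\ psdmx (A - \matrix_(i, j) (z i * z j)),
        forall j, A s j = z s * z j & forall j, A s j = 0 -> z j = 0].
Proof.
move=> pA; have symA := psd_sym pA; have Ass := psd_diag s pA.
exists (fun i => A s i / Num.sqrt (A s s)).
pose z i := A s i / Num.sqrt (A s s); rewrite -/z.
have zz i j : z i * z j = A s i * A s j / A s s.
  by rewrite /z mulrACA -invfM -expr2 sqr_sqrtr.
split=> [|j|j]; last by rewrite /z => ->; rewrite mul0r.
  apply/psdmxE; split.
    by rewrite linearB /= symA (psd_sym (psd_rank1 z)).
  move=> x _; rewrite qformB qform_rank1.
  have [As0|As0] := eqVneq (A s s) 0.
    rewrite big1 ?expr0n ?subr0 ?psd_qform // => i _.
    by rewrite /z As0 sqrtr0 invr0 !mulr0.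
  have := psd_qform (fun i => x i + - (\sum_j A s j * x j) / A s s * (i == s)%:R) pA.
  rewrite qform_shift //.
  have -> : \sum_i x i * z i = (\sum_j A s j * x j) / Num.sqrt (A s s).
    by rewrite mulr_suml; apply: eq_bigr => i _; rewrite /z mulrA (mulrC (x i)).
  rewrite [X in _ -> 0 <= _ - X]expr_div_n sqr_sqrtr //; congr (0 <= _).
  by field.
rewrite -/(z s) -/(z j) zz; have [As0|As0] := eqVneq (A s s) 0.
  by rewrite (psd_row0 j pA As0) mulr0 mul0r.
by rewrite mulrAC divff // mul1r.
Qed.

Lemma psd_onD S K D : psd_on S K -> psd_on S D -> psd_on S (K + D).
Proof. by move=> pK pD x x0; rewrite qformD addr_ge0 ?pK ?pD. Qed.

(** Schur product theorem.  The entrywise product of [D] with [z z^T] has the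
form of [D] evaluated at the rescaled vector [x_i z_i], so it is enough to peel
rank one terms off [C]; each step cancels a nonzero diagonal entry. *)
Lemma schur S C D : psdmx C -> psd_on S D ->
  psd_on S (\matrix_(i, j) (C i j * D i j)).
Proof.
move=> pC pD.
have [m le_m] : exists m, (#|[set i | C i i != 0%R]| <= m)%N by eexists.
elim: m C pC le_m => [|m IHm] C pC le_m x x0.
  suff C0 i j : C i j = 0.
    by apply: sumr_ge0 => i _; apply: sumr_ge0 => j _; rewrite mxE C0 mul0r mulr0.
  move: le_m; rewrite leqn0 cards_eq0 => /eqP/setP/(_ i).
  by rewrite !inE => /negbFE/eqP /psd_row0 ->.
have [C0|[s]] := set_0Vmem [set i | C i i != 0].
  by apply: IHm => //; rewrite C0 cards0.
rewrite inE => Cs; have [z [pC' Csz z0]] := psd_peel s pC.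
pose C' := C - \matrix_(i, j) (z i * z j).
have -> : \matrix_(i, j) (C i j * D i j) =
   \matrix_(i, j) (z i * z j * D i j) + \matrix_(i, j) (C' i j * D i j).
  by apply/matrixP => i j; rewrite !mxE -mulrDl subrKC.
rewrite qformD addr_ge0 //.
  suff -> : qform (\matrix_(i, j) (z i * z j * D i j)) x =
            qform D (fun i => x i * z i).
    by apply: pD => i /x0 ->; rewrite mul0r.
  by apply: eq_bigr => i _; apply: eq_bigr => j _; rewrite mxE; ring.
apply: IHm x0 => //; rewrite -ltnS; apply: leq_trans le_m.
apply: proper_card; apply/properP; split; last first.
  by exists s; rewrite !inE // !mxE Csz subrr eqxx.
apply/fintype.subsetP => i; rewrite !inE !mxE; apply: contra => /eqP Ci.
suff zi : z i = 0 by rewrite Ci zi mul0r subrr.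
apply: z0; rewrite -(psd_sym pC) mxE; exact: psd_row0.
Qed.

End QuadraticForms.

(** * Signed powers and their derivatives *)

Section SignedPowers.
Context {R : realType}.
Implicit Types (p x y : R) (s : bool).

Definition spow s p x : R := Num.sg x ^+ s * `|x| `^ p.

Lemma phi_spow p : phi p = spow false p.
Proof. by apply/funext => x; rewrite /spow mul1r. Qed.

Lemma psi_spow p : psi p = spow true p.
Proof. by []. Qed.

Lemma spowM s p : {morph spow s p : x y / x * y}.
Proof.
by move=> x y; rewrite /spow sgrM exprMn normrM powRM // mulrACA.
Qed.

Lemma spow_pos s p x : 0 < x -> spow s p x = x `^ p.
Proof. by move=> x0; rewrite /spow gtr0_sg // expr1n mul1r gtr0_norm. Qed.

Lemma spow_mono s p x y : 0 <= p -> 0 <= x -> x <= y -> spow s p x <= spow s p y.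
Proof.
move=> p0 x0 xy; have y0 := le_trans x0 xy.
have [<-//|x_neq0] := eqVneq 0 x; last first.
  have x_gt0 : 0 < x by rewrite lt_def eq_sym x_neq0.
  rewrite !spow_pos ?(lt_le_trans x_gt0) //.
  by rewrite ge0_ler_powR ?nnegrE.
move: y0; rewrite le_eqVlt => /predU1P[<-//|y0].
rewrite (spow_pos _ _ y0) /spow sgr0 normr0; case: s => /=.
  by rewrite expr1 mul0r powR_ge0.
by rewrite !mul1r ge0_ler_powR ?nnegrE // ltW.
Qed.

Lemma spow1_nneg s x : 0 <= x -> spow s 1 x = x.
Proof.
rewrite le_eqVlt => /predU1P[<-|x0]; last by rewrite spow_pos // powRr1 // ltW.
by rewrite /spow normr0 powRr1 // mulr0.
Qed.

Lemma norm_spow_le s p x : `|spow s p x| <= `|x| `^ p.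
Proof.
rewrite normrM (ger0_norm (powR_ge0 _ _)) ler_piMl ?powR_ge0 //.
by rewrite normrX exprn_ile1 // normr_sg lern1 leq_b1.
Qed.

Lemma spow0 s p : p != 0 -> spow s p 0 = 0.
Proof. by move=> p0; rewrite /spow normr0 powR0 ?mulr0. Qed.

Lemma spow_shift s p x : 0 < p -> spow s p x = x * spow (~~ s) (p - 1) x.
Proof.
move=> p0; rewrite /spow -mulr_powRB1 // mulrA [RHS]mulrA; congr (_ * _).
case: s; first by rewrite /= expr1 expr0 mulr1 -numEsg.
by rewrite /= expr0 expr1 mul1r mulrC -normrEsg.
Qed.

(** Away from the origin the sign is locally constant and the power rule
applies.  At the origin the slope is itself a power of exponent [p - 1 > 0] by
[spow_shift], and so tends to zero. *)
Lemma is_derive_spow s p x : 1 < p ->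
  is_derive x 1 (spow s p) (p * spow (~~ s) (p - 1) x).
Proof.
move=> p1; have p_gt0 : 0 < p by apply: lt_trans p1.
have pB1 : 0 < p - 1 by rewrite subr_gt0.
have [->|x0] := eqVneq x 0.
  rewrite spow0 ?gt_eqF // mulr0.
  suff slope0 : (h^-1 *: (spow s p (h *: 1 + 0) - spow s p 0)
                 @[h --> 0^'] --> (0 : R))%classic.
    by apply: DeriveDef; [apply/cvg_ex; exists 0|exact/cvg_lim].
  apply/cvgr0Pnorm_lt => e e0.
  have d0 : 0 < e `^ (p - 1)^-1 by exact: powR_gt0.
  near=> h.
  have h0 : h != 0 by near: h; exact: nbhs_dnbhs_neq.
  rewrite [_ *: 1]mulr1 addr0 spow0 ?gt_eqF // subr0 spow_shift // scalerA.
  rewrite mulVf // scale1r; apply: le_lt_trans (norm_spow_le _ _ _) _.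
  have -> : e = (e `^ (p - 1)^-1) `^ (p - 1).
    by rewrite -powRrM mulVf ?gt_eqF // powRr1 // ltW.
  rewrite gt0_ltr_powR ?nnegrE // ?(ltW d0) //.
  by near: h; exact: dnbhs0_lt.
have sg_near : \forall y \near x, Num.sg y = Num.sg x.
  move: x0; rewrite neq_lt => /orP[x_lt0|x_gt0].
    near=> y; rewrite (ltr0_sg x_lt0) ltr0_sg //.
    by near: y; exact: lt_nbhsl.
  near=> y; rewrite (gtr0_sg x_gt0) gtr0_sg //.
  by near: y; exact: lt_nbhsr.
pose e := Num.sg x.
have ex : e * x = `|x| by rewrite -normrEsg.
apply: (@near_eq_is_derive _ _ _ (fun y => e ^+ s * (e * y) `^ p)).
  near=> y; have sgy : Num.sg y = e by near: y.
  by rewrite /spow /= [`|y|]normrEsg sgy.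
have pow' : is_derive (e * x) 1 (@powR R ^~ p) (p * (e * x) `^ (p - 1)).
  by apply: is_derive1_powR; rewrite ex normr_gt0.
have mul' : is_derive x 1 ( *%R e) e.
  have := is_deriveZ e (is_derive_id x 1); rewrite [_ *: 1]mulr1.
  by [].
have comp' := is_derive1_comp pow' mul'.
have := is_deriveZ (e ^+ s) comp'.
congr is_derive; rewrite ex /spow -/e.
have ee : e * e = 1 by rewrite -expr2 sqr_sg x0.
set P := `|x| `^ _; rewrite -[LHS]/(_ * (p * P * e)).
case: (s) => /=; rewrite ?expr0 ?expr1; last by ring.
by rewrite (mulrC (p * P)) mulrA ee; ring.
Unshelve. all: by end_near. Qed.

End SignedPowers.

(** * Positivity, monotonicity and convexity through derivatives *)

Section Transfer.
Context {R : realType} {n : nat}.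
Implicit Types (f df : R -> R) (m : nat) (A B C K : 'M[R]_n) (x : 'I_n -> R).
Implicit Types (S : {set 'I_n}).

(** The three classes of functions, tested on principal submatrices of size at
most [m] of matrices whose full size [n] is fixed: an induction on [m] then
needs no change of matrix type. *)
Definition pos_on f m : Prop :=
  forall S A, (#|S| <= m)%N -> psdmx A -> psd_on S (map_mx f A).

Definition mono_on f m : Prop :=
  forall S A B, (#|S| <= m)%N -> psdmx B -> psdmx (A - B) ->
    psd_on S (map_mx f A - map_mx f B).

Definition conv_on f m : Prop :=
  forall S A B l, (#|S| <= m)%N -> psdmx B -> psdmx (A - B) -> 0 <= l <= 1 ->
    psd_on S (l *: map_mx f A + (1 - l) *: map_mx f B
              - map_mx f (l *: A + (1 - l) *: B)).

(** Peel off a rank one matrix [Z] agreeing with [A] on row [s]: [f[Z]] has rank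
one because [f] is multiplicative, and [f[A] - f[Z]] lives on [S :\ s]. *)
Lemma pos_on_of_mono f m : {morph f : x y / x * y} ->
  mono_on f m -> pos_on f m.+1.
Proof.
move=> fM monof S A leS pA.
have [S0|[s sS]] := set_0Vmem S.
  move=> x x0; rewrite /qform big1 // => i _; rewrite big1 // => j _.
  by rewrite x0 ?mul0r // S0 inE.
have [z [pC Asz _]] := psd_peel s pA.
set Z := \matrix_(i, j) (z i * z j) in pC.
have -> : map_mx f A = map_mx f Z + (map_mx f A - map_mx f Z) by rewrite subrKC.
apply: psd_onD => x x0.
  suff -> : map_mx f Z = \matrix_(i, j) (f (z i) * f (z j)).
    by rewrite qform_rank1 sqr_ge0.
  by apply/matrixP => i j; rewrite !mxE fM.
rewrite (@qform_drop _ _ _ _ s) => [|i j].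
  apply: (monof (S :\ s)) => //; last 2 first.
  - exact: psd_rank1.
  - move=> i; rewrite !inE negb_and negbK; case: eqVneq => //= _; exact: x0.
  - by rewrite -ltnS -add1n; move: leS; rewrite (cardsD1 s) sS.
move=> /orP[]/eqP->; rewrite !mxE; last rewrite -(psd_sym pA) mxE (mulrC (z i)).
all: by rewrite Asz subrr.
Qed.

Lemma map_mxZ (c : R) f A : map_mx (fun y => c * f y) A = c *: map_mx f A.
Proof. by apply/matrixP => i j; rewrite !mxE. Qed.

Lemma pos_onZ (c : R) f m : 0 <= c -> pos_on f m -> pos_on (fun y => c * f y) m.
Proof.
move=> c0 posf S A leS pA x x0.
by rewrite map_mxZ qformZ mulr_ge0 //; apply: posf x0.
Qed.

Lemma mono_onZ (c : R) f m :
  0 <= c -> mono_on f m -> mono_on (fun y => c * f y) m.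
Proof.
move=> c0 monof S A B leS pB pC x x0.
by rewrite !map_mxZ -scalerBr qformZ mulr_ge0 //; apply: monof x0.
Qed.

Lemma is_derive_line f df B C x (t : R) : (forall y : R, is_derive y 1 f (df y)) ->
  is_derive t 1 (fun u : R => qform (map_mx f (B + u *: C)) x)
    (qform (\matrix_(i, j) (C i j * map_mx df (B + t *: C) i j)) x).
Proof.
move=> f'.
have sum' (h : 'I_n -> R -> R) (dh : 'I_n -> R) :
    (forall i, is_derive t 1 (h i) (dh i)) ->
    is_derive t 1 (fun u : R => \sum_i h i u) (\sum_i dh i).
  move=> h'; rewrite (_ : (fun u => _) = \sum_i h i); first exact: is_derive_sum.
  by apply/funext => u; rewrite fct_sumE.
apply: (sum' _) => i; apply: (sum' _) => j.
pose g (u : R) := B i j + u * C i j.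
have g' : is_derive t 1 g (C i j).
  have := is_deriveD (is_derive_cst (B i j) t 1)
    (is_deriveZ (C i j) (is_derive_id t 1)).
  rewrite add0r [_ *: 1]mulr1; congr is_derive.
  by apply/funext => u; rewrite /g mulrC.
have := is_deriveZ (x i * x j) (is_derive1_comp (f' (g t)) g').
by congr is_derive; [apply/funext => u|]; rewrite !mxE // -[LHS]/(_ * _) (mulrC (df _)).
Qed.

Lemma psd_line A B t : 0 <= t -> psdmx B -> psdmx (A - B) ->
  psdmx (B + t *: (A - B)).
Proof. by move=> t0 pB pC; apply: psdD => //; apply: psdZ. Qed.

Lemma mvt_derivable (h dh : R -> R) (a b : R) :
    (forall t : R, is_derive t 1 h (dh t)) -> a <= b ->
  exists2 c, a <= c <= b & h b - h a = dh c * (b - a).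
Proof.
move=> h' ab.
have [c cab ->] := MVT_segment ab (fun t _ => h' t)
  (derivable_within_continuous (fun t _ => @ex_derive _ _ _ _ _ _ _ (h' t))).
by exists c => //; rewrite in_itv in cab.
Qed.

Lemma mono_on_of_pos f df m : (forall y : R, is_derive y 1 f (df y)) ->
  pos_on df m -> mono_on f m.
Proof.
move=> f' posdf S A B leS pB pC x x0.
have h' t := is_derive_line B (A - B) x t f'.
have [c /andP[c0 _]] := mvt_derivable h' (@ler01 R).
rewrite subr0 mulr1 scale1r subrKC scale0r addr0 -qformB => ->.
by apply: schur x0 => //; apply: posdf => //; apply: psd_line.
Qed.

(** The mean value theorem on both sides of [l] turns the convexity defect into
[l (1 - l)] times the difference of two slopes of the quadratic form along the
segment; the later slope is larger because [df] is monotone. *)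
Lemma conv_on_of_mono f df m : (forall y : R, is_derive y 1 f (df y)) ->
  mono_on df m -> conv_on f m.
Proof.
move=> f' monodf S A B l leS pB pC /andP[l0 l1] x x0.
have h' t := is_derive_line B (A - B) x t f'.
have [c /andP[c0 cl]] := mvt_derivable h' l0.
have [d /andP[ld _]] := mvt_derivable h' l1.
rewrite scale1r subrKC scale0r addr0.
have -> : B + l *: (A - B) = l *: A + (1 - l) *: B.
  by rewrite scalerBr scalerBl scale1r addrCA addrA.
set K1 := \matrix_(i, j) _ => eq1; set K0 := \matrix_(i, j) _ => eq0.
rewrite qformB qformD !qformZ.
suff : 0 <= qform K1 x - qform K0 x.
  move=> dK; have := mulr_ge0 (mulr_ge0 l0 (_ : 0 <= 1 - l)) dK.
  rewrite subr_ge0 => /(_ l1).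
  nra.
rewrite -qformB.
suff -> : K1 - K0 = \matrix_(i, j) ((A - B) i j *
    (map_mx df (B + d *: (A - B)) - map_mx df (B + c *: (A - B))) i j).
  apply: schur x0 => //; apply: monodf => //; first exact: psd_line.
  rewrite opprD addrACA subrr add0r -scalerBl.
  by apply: psdZ => //; rewrite subr_ge0 (le_trans cl).
by apply/matrixP => i j; rewrite !mxE; ring.
Qed.

Lemma psd_on_card1 S K : (#|S| <= 1)%N -> (forall i, 0 <= K i i) -> psd_on S K.
Proof.
move=> leS K0 x x0; have [S0|[s sS]] := set_0Vmem S.
  by rewrite /qform big1 // => i _; rewrite big1 // => j _;
    rewrite x0 ?mul0r // S0 inE.
rewrite (@qform_single _ _ _ _ s) => [|i si].
  by rewrite mulr_ge0 // sqr_ge0.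
apply: x0; apply: contraTN leS => iS.
by rewrite -ltnNge (cardsD1 s) sS (cardsD1 i) !inE si iS.
Qed.

(** In size two, changing the sign of the off-diagonal entry of [C] amounts to
changing the sign of one coordinate, so both choices of sign give a nonnegative
form; as the form is affine in this entry, so does every value in between. *)
Lemma psd_on_card2 S C K : (#|S| <= 2)%N -> psdmx C -> K^T = K ->
    (forall i, K i i = C i i) -> (forall i j, `|K i j| <= `|C i j|) ->
  psd_on S K.
Proof.
move=> leS pC symK diagK leK.
have [/cards2P[a [b [ab ->]]]|S2] := boolP (#|S| == 2); last first.
  apply: psd_on_card1 => [|i]; last by rewrite diagK psd_diag.
  by rewrite -ltnS ltn_neqAle S2.
move=> x x0; rewrite (qform_pair symK ab x0) !diagK.
(* at [e = 1] and [e = -1] the mixed term has opposite signs *)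
pose y (e : R) i := if i == a then e * x a else x i.
have qy e : qform C (y e) = e ^+ 2 * (x a ^+ 2 * C a a)
    + e * (2 * (x a * x b * C a b)) + x b ^+ 2 * C b b.
  rewrite (qform_pair (psd_sym pC) ab) => [|i iab].
    by rewrite /y eqxx eq_sym (negPf ab); ring.
  move: (iab); rewrite /y !inE negb_or => /andP[/negPf-> _]; exact: x0.
have := psd_qform (y 1) pC; have := psd_qform (y (- 1)) pC; rewrite !qy.
have : `|x a * x b * K a b| <= `|x a * x b * C a b|.
  by rewrite normrM [leRHS]normrM ler_wpM2l.
rewrite ler_norml => /andP[]; case: (ger0P (_ * C a b)) => *; lra.
Qed.

End Transfer.

(** * The thresholds for power functions *)

Section Powers.
Context {R : realType} {n : nat}.
Implicit Types (p : R) (s : bool).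

Lemma spow_mono_on_scalar s p : 0 <= p -> @mono_on R n (spow s p) 1.
Proof.
move=> p0 S A B leS pB pC; apply: psd_on_card1 => // i.
rewrite !mxE subr_ge0 spow_mono ?psd_diag //.
by have := psd_diag i pC; rewrite !mxE subr_ge0.
Qed.

(** For [p = 1] the function [|x|] is not differentiable at the origin.  The
functions are the identity on the diagonal entries and 1-Lipschitz on the
others, so the difference is compared with [A - B] itself. *)
Lemma spow1_mono_on s : @mono_on R n (spow s 1) 2.
Proof.
move=> S A B leS pB pC; have pA : psdmx A by rewrite -(subrK B A); apply: psdD.
apply: psd_on_card2 leS pC _ _ _ => [|i|i j].
- by rewrite linearB /= !map_trmx !psd_sym.
- by rewrite !mxE !spow1_nneg ?psd_diag.
rewrite !mxE; case: s => /=.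
  by rewrite /spow !powRr1 // !expr1 -!numEsg.
by rewrite /spow !expr0 !mul1r !powRr1 // ler_dist_dist.
Qed.

(** The derivative lowers the exponent by one, and [pos_on_of_mono] gives back
the unit of size. *)
Lemma spow_mono_on m s p : m%:R <= p -> @mono_on R n (spow s p) m.+1.
Proof.
elim: m s p => [|m IHm] s p le_mp; first exact: spow_mono_on_scalar.
have le_mpB1 : m%:R <= p - 1 by rewrite lerBrDr natr1.
have : 1 <= p by apply: le_trans le_mp; rewrite ler1n.
rewrite le_eqVlt => /predU1P[p1|p1].
  move: le_mp; rewrite -p1 lern1 ltnS leqn0 => /eqP ->.
  exact: spow1_mono_on.
apply: mono_on_of_pos => [y|]; first exact: is_derive_spow.
apply: pos_onZ; first by rewrite ltW // (lt_trans _ p1).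
by apply: pos_on_of_mono; [exact: spowM|exact: IHm].
Qed.

Lemma spow_pos_on m s p : m%:R <= p -> @pos_on R n (spow s p) m.+2.
Proof.
by move=> mp; apply: pos_on_of_mono; [exact: spowM|exact: spow_mono_on].
Qed.

Lemma spow_conv_on m s p : m.+1%:R <= p -> @conv_on R n (spow s p) m.+1.
Proof.
move=> le_mp; have le_mpB1 : m%:R <= p - 1 by rewrite lerBrDr natr1.
have : 1 <= p by apply: le_trans le_mp; rewrite ler1n.
rewrite le_eqVlt => /predU1P[p1|p1]; last first.
  apply: conv_on_of_mono => [y|]; first exact: is_derive_spow.
  by apply: mono_onZ; [rewrite ltW // (lt_trans _ p1)|exact: spow_mono_on].
(* [p = 1] forces size one, where the functions are linear on the diagonal *)
move: le_mp; rewrite -p1 lern1 ltnS leqn0 => /eqP ->.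
move=> S A B l leS pB pC /andP[l0 l1]; apply: psd_on_card1 => // i.
have pA : psdmx A by rewrite -(subrK B A); apply: psdD.
have A0 := psd_diag i pA; have B0 := psd_diag i pB.
by rewrite !mxE !spow1_nneg ?subrr // addr_ge0 ?mulr_ge0 // subr_ge0.
Qed.

Lemma S_pos_of_on (f : R -> R) : @pos_on R n f n -> S_pos n f.
Proof.
move=> posf A pA; apply/psdmxE; split; first by rewrite map_trmx psd_sym.
by apply: posf => //; rewrite cardsT card_ord.
Qed.

Lemma S_mono_of_on (f : R -> R) : @mono_on R n f n -> S_mono n f.
Proof.
move=> monof A B /symmetricmxP symA /symmetricmxP symB pC pB.
apply/psdmxE; split; first by rewrite linearB /= !map_trmx symA symB.
by apply: monof => //; rewrite cardsT card_ord.
Qed.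

Lemma S_conv_of_on (f : R -> R) : @conv_on R n f n -> S_conv n f.
Proof.
move=> convf A B /symmetricmxP symA /symmetricmxP symB pC pB l l01.
apply/psdmxE; split; last by apply: convf => //; rewrite cardsT card_ord.
by rewrite linearB linearD !linearZ /= !map_trmx linearD !linearZ /= symA symB.
Qed.

End Powers.

Theorem theorem5p1 (R : realType) (n : nat) (p : R) (hp : 0 <= p) :
  [/\ (2 <= n)%N -> n%:R - 2 <= p -> S_pos n (phi p) /\ S_pos n (psi p),
      (1 <= n)%N -> n%:R - 1 <= p -> S_mono n (phi p) /\ S_mono n (psi p)
    & (1 <= n)%N -> n%:R <= p -> S_conv n (phi p) /\ S_conv n (psi p)].
Proof.
rewrite phi_spow psi_spow; split.
- case: n => [|[|m]] // _; rewrite -addn2 natrD addrK => mp.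
  by rewrite addn2; split; apply/S_pos_of_on/spow_pos_on.
- case: n => [|m] // _; rewrite -natr1 addrK => mp.
  by split; apply/S_mono_of_on/spow_mono_on.
- case: n => [|m] // _ mp.
  by split; apply/S_conv_of_on/spow_conv_on.
Qed.
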